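(* For every integer $k\ge 0$, the cubic graph $T_k$ (defined in the context) has no $4$-weak bisection. That is, there is no partition of $V(T_k)$ into two disjoint sets $V_1,V_2$ with $|V_1|=|V_2|$ such that every connected component of each of the two induced subgraphs $T_k[V_1]$ and $T_k[V_2]$ is a tree on at most $2$ vertices.
   Context: Graphs are finite and simple. The graphs $L_k$, $k\ge 0$: $L_0$ is the graph obtained from the complete bipartite graph $K_{3,3}$ by removing one edge; it has exactly two vertices of degree $2$ (the endpoints of the removed edge), and all its other vertices have degree $3$. For $k\ge 1$, $L_k$ is obtained from $L_{k-1}$, whose two vertices of degree $2$ are denoted $a$ and $b$, by adding two new vertices $u,v$ and the three edges $ua$, $vb$, $uv$; thus $u$ and $v$ are the only two vertices of degree $2$ in $L_k$, and all other vertices have degree $3$. The graphs $L'_k$: for $k\ge 0$, $L'_k$ is obtained from $L_k$ by adding one new vertex adjacent to the two vertices of degree $2$ of $L_k$; this new vertex is the only vertex of degree $2$ in $L'_k$. The graphs $T_k$: for $k\ge 0$, $T_k$ is obtained from the disjoint union of one copy of $L'_k$ and two copies of $L'_0$ by adding one new vertex adjacent to the three vertices of degree $2$ (one in each copy). The graph $T_k$ is cubic. A bisection of a cubic graph $G=(V,E)$ is a partition of $V$ into two disjoint subsets $V_1,V_2$ with $|V_1|=|V_2|$. For an integer $k\ge 3$, a $k$-weak bisection of $G$ is a bisection $(V_1,V_2)$ such that every connected component of each of the two subgraphs of $G$ induced by $V_1$ and by $V_2$ is a tree on at most $k-2$ vertices. *)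

(* Defs.v *)
From HB Require Import structures.
From mathcomp Require Import all_boot.

Set Implicit Arguments.
Unset Strict Implicit.
Unset Printing Implicit Defensive.

Record sgraph := SGraph {
  vertex :> finType;
  edge : rel vertex;
  edge_sym : symmetric edge;
  edge_irr : irreflexive edge
}.
Arguments edge {s} : rename.

Definition deg (G : sgraph) (x : G) : nat := #|[set y | edge x y]|.

Definition deg2 (G : sgraph) : {set G} := [set x | deg x == 2].

Definition cubic (G : sgraph) : Prop := forall x : G, deg x = 3.

Section Induced.
Variables (G : sgraph) (A : {set G}).

Definition induced_edge : rel {x : G | x \in A} :=
  fun x y => edge (val x) (val y).

Lemma induced_edge_sym : symmetric induced_edge.
Proof. by move=> x y; apply: edge_sym. Qed.

Lemma induced_edge_irr : irreflexive induced_edge.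
Proof. by move=> x; apply: edge_irr. Qed.

Definition induced : sgraph := SGraph induced_edge_sym induced_edge_irr.

End Induced.

Definition component (G : sgraph) (x : G) : {set G} :=
  [set y | connect edge x y].

Definition connected (G : sgraph) : Prop :=
  0 < #|G| /\ forall x y : G, connect edge x y.

(* An edge xy makes [:: x; y] a [ucycle] of [edge]; the cycles of a simple
   graph are those of length at least 3. *)
Definition acyclic (G : sgraph) : Prop :=
  forall c : seq G, 3 <= size c -> ~ ucycle edge c.

Definition is_tree (G : sgraph) : Prop := connected G /\ acyclic G.

Definition bisection (G : sgraph) (V1 V2 : {set G}) : Prop :=
  [/\ V1 :|: V2 = [set: G], [disjoint V1 & V2] & #|V1| = #|V2|].

Definition tree_components (n : nat) (G : sgraph) : Prop :=
  forall x : G, is_tree (induced (component x)) /\ #|component x| <= n.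

(* Only meant for 3 <= k, so that the subtraction is not truncated. *)
Definition weak_bisection (k : nat) (G : sgraph) (V1 V2 : {set G}) : Prop :=
  [/\ bisection V1 V2,
      tree_components (k - 2) (induced V1)
    & tree_components (k - 2) (induced V2)].

Section AddVertex.
Variables (G : sgraph) (S : {set G}).

Definition add_vertex_edge : rel (option G) := fun x y =>
  match x, y with
  | Some x', Some y' => edge x' y'
  | Some z, None | None, Some z => z \in S
  | None, None => false
  end.

Lemma add_vertex_edge_sym : symmetric add_vertex_edge.
Proof. by move=> [x|] [y|] //=; apply: edge_sym. Qed.

Lemma add_vertex_edge_irr : irreflexive add_vertex_edge.
Proof. by move=> [x|] //=; apply: edge_irr. Qed.

(* [None] is the new vertex, with neighbourhood [S]. *)
Definition add_vertex : sgraph :=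
  SGraph add_vertex_edge_sym add_vertex_edge_irr.

End AddVertex.

Section DisjointUnion.
Variables G H : sgraph.

Definition dunion_edge : rel (G + H)%type := fun x y =>
  match x, y with
  | inl x', inl y' => edge x' y'
  | inr x', inr y' => edge x' y'
  | _, _ => false
  end.

Lemma dunion_edge_sym : symmetric dunion_edge.
Proof. by move=> [x|x] [y|y] //=; apply: edge_sym. Qed.

Lemma dunion_edge_irr : irreflexive dunion_edge.
Proof. by move=> [x|x] //=; apply: edge_irr. Qed.

Definition dunion : sgraph := SGraph dunion_edge_sym dunion_edge_irr.

End DisjointUnion.

(* K_{3,3} has parts [(false, _)] and [(true, _)]; the edge joining
   [(false, 0)] and [(true, 0)] is removed. *)
Definition K33_minus_edge : rel (bool * 'I_3) := fun x y =>
  (x.1 != y.1) && ~~ ((x.2 == ord0) && (y.2 == ord0)).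

Lemma K33_minus_edge_sym : symmetric K33_minus_edge.
Proof.
by move=> x y; rewrite /K33_minus_edge eq_sym [(x.2 == _) && _]andbC.
Qed.

Lemma K33_minus_edge_irr : irreflexive K33_minus_edge.
Proof. by move=> x; rewrite /K33_minus_edge eqxx. Qed.

Definition L0 : sgraph := SGraph K33_minus_edge_sym K33_minus_edge_irr.

(* The recursion needs names for the two vertices of degree 2, so they are
   carried along with the graph; [deg2_L] below shows that they are exactly
   the vertices of degree 2. *)
Record tgraph := TGraph { tg :> sgraph; term_a : tg; term_b : tg }.

(* u = [Some None] is joined to a, then v = [None] is joined to b and u. *)
Definition L_step (G : tgraph) : tgraph :=
  let Gu := add_vertex [set term_a G] in
  let Guv := add_vertex [set (Some (term_b G) : Gu); (None : Gu)] in
  @TGraph Guv (Some None) None.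

Fixpoint L (k : nat) : tgraph :=
  if k is k'.+1 then L_step (L k')
  else @TGraph L0 (false, ord0) (true, ord0).

Definition L' (k : nat) : sgraph := add_vertex (deg2 (L k)).

Definition T (k : nat) : sgraph :=
  add_vertex (deg2 (dunion (L' k) (dunion (L' 0) (L' 0)))).

Lemma degE (G : sgraph) (x : G) : deg x = \sum_(y : G) edge x y.
Proof.
rewrite /deg -sum1_card big_mkcond /=.
by apply: eq_bigr => y _; rewrite inE; case: edge.
Qed.

Lemma big_optionE (X : finType) (F : option X -> nat) :
  \sum_(y : option X) F y = F None + \sum_(y : X) F (Some y).
Proof.
rewrite (bigD1 None) //=; congr addn.
rewrite (reindex_omap Some id) /=; last by case=> [y|] //; rewrite eqxx.
by apply: eq_bigl => y; rewrite eqxx.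
Qed.

Lemma deg_add_Some (G : sgraph) (S : {set G}) (x : G) :
  deg (Some x : add_vertex S) = (x \in S) + deg x.
Proof. by rewrite !degE big_optionE. Qed.

Lemma deg_add_None (G : sgraph) (S : {set G}) :
  deg (None : add_vertex S) = #|S|.
Proof.
rewrite degE big_optionE /= add0n -sum1_card [RHS]big_mkcond /=.
by apply: eq_bigr => y _; case: (y \in S).
Qed.

Lemma deg_dunion_inl (G H : sgraph) (x : G) : deg (inl x : dunion G H) = deg x.
Proof. by rewrite !degE big_sumType /= [X in _ + X]big1 ?addn0. Qed.

Lemma deg_dunion_inr (G H : sgraph) (x : H) : deg (inr x : dunion G H) = deg x.
Proof. by rewrite !degE big_sumType /= [X in X + _]big1 ?add0n. Qed.

Lemma deg_L (k : nat) : term_a (L k) != term_b (L k) /\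
  forall x : L k, deg x = (if x \in [set term_a (L k); term_b (L k)] then 2 else 3).
Proof.
elim: k => [|k [abN degk]].
  split=> // -[s i]; rewrite degE /= (eq_bigr (fun y =>
    ((s != y.1) && ~~ ((i == ord0) && (y.2 == ord0)) : nat))) //.
  rewrite -(pair_bigA _ (fun b j =>
    ((s != b) && ~~ ((i == ord0) && (j == ord0)) : nat))) /=.
  rewrite big_bool /= !big_ord_recl !big_ord0 !inE.
  by case: s; case: i => [[|[|[|?]]] ?].
split=> //= -[[x|]|].
- rewrite !deg_add_Some degk !inE.
  change (Some x == Some (term_b (L k))) with (x == term_b (L k)).
  rewrite /= !orbF.
  have [->|xa] := eqVneq x (term_a (L k)); first by rewrite (negPf abN).
  by case: (x == _).
- by rewrite deg_add_Some deg_add_None cards1 !inE.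
- by rewrite deg_add_None cards2 !inE.
Qed.

Lemma deg2_L (k : nat) : deg2 (L k) = [set term_a (L k); term_b (L k)].
Proof.
by apply/setP => x; rewrite inE (deg_L k).2; case: (x \in _).
Qed.

Lemma deg_L' (k : nat) (x : L' k) : deg x = (if x is Some _ then 3 else 2).
Proof.
case: x => [x|]; last by rewrite deg_add_None deg2_L cards2 (deg_L k).1.
by rewrite deg_add_Some deg2_L (deg_L k).2; case: (x \in _).
Qed.

Lemma cubic_T (k : nat) : cubic (T k).
Proof.
case=> [x|].
  rewrite deg_add_Some inE.
  suff : (deg x == 2) || (deg x == 3) by case/orP => /eqP->.
  by case: x => [x|[x|x]];
     rewrite ?deg_dunion_inl ?deg_dunion_inr ?deg_dunion_inl ?deg_dunion_inr
             deg_L'; case: x.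
rewrite deg_add_None.
pose D := dunion (L' k) (dunion (L' 0) (L' 0)).
pose n1 : D := inl None; pose n2 : D := inr (inl None).
pose n3 : D := inr (inr None).
rewrite (_ : deg2 _ = [set n1; n2; n3]).
  by rewrite -setUA cardsU1 cards2 !inE.
apply/setP => x; rewrite !inE.
by case: x => [x|[x|x]];
   rewrite ?deg_dunion_inl ?deg_dunion_inr ?deg_dunion_inl ?deg_dunion_inr
           deg_L'; case: x.
Qed.

(* Main.v *)
Require Import Defs.
From mathcomp Require Import all_boot.
From mathcomp Require Import zify.

(* In a 4-weak bisection every vertex has at most one neighbour in its own
   class.  In K_{3,3} minus an edge this forces the two parts to be the two
   classes, so the terminals lie in different classes.  Inductively, each L_k
   is balanced with its two terminals in different classes: if the new vertices
   u and v had the same class, the one attached to the old terminal of that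
   class would have two neighbours in it.  Hence the degree-2 vertex of each
   L'_k already has a neighbour in its own class and unbalances its copy by
   one.  The last vertex of T_k must then lie opposite to all three of its
   neighbours, which leaves an imbalance of 3 - 1 = 2. *)

(** Two-colourings of defect 1: each colour class induces a graph of maximum degree at most 1. *)
Definition defective {G : sgraph} (c : G -> bool) : Prop :=
  forall x y z : G, edge x y -> edge x z -> c y = c x -> c z = c x -> y = z.

Definition balanced {X : finType} (c : X -> bool) : Prop :=
  \sum_x (c x : nat) = \sum_x (~~ c x : nat).

Lemma defective_comp (G H : sgraph) (f : G -> H) (c : H -> bool) :
  injective f -> {homo f : x y / edge x y} ->
  defective c -> defective (c \o f).
Proof.
move=> finj fE dc x y z xy xz cy cz; apply: finj.
exact: (dc _ _ _ (fE _ _ xy) (fE _ _ xz)).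
Qed.

Lemma defective_Some (G : sgraph) (S : {set G}) (c : add_vertex S -> bool) :
  defective c -> defective (c \o (Some : G -> add_vertex S)).
Proof. by apply: defective_comp => // x y []. Qed.

(** Otherwise [x], [y], [z] would be three distinct vertices of one component. *)
Lemma tree_components2_edge (G : sgraph) (A : {set G}) (x y z : G) :
  tree_components 2 (induced A) -> x \in A -> y \in A -> z \in A ->
  edge x y -> edge x z -> y = z.
Proof.
move=> tA xA yA zA xy xz; apply/eqP; apply: contraT => yz.
pose x' : induced A := Sub x xA; pose y' : induced A := Sub y yA.
pose z' : induced A := Sub z zA.
have [_] := tA x'; rewrite leqNgt => /negP[].
have <- : #|[set x'; y'; z']| = 3.
  rewrite -setUA cardsU1 cards2 !inE -!(inj_eq val_inj) /= yz negb_or.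
  by do 2![case: eqP => [xE|_]; first by move: xy xz; rewrite -xE edge_irr].
apply/subset_leq_card/subsetP => t; rewrite !inE -orbA.
by case/or3P => /eqP->; rewrite ?connect0 ?connect1.
Qed.

Lemma weak_bisection4_coloring (G : sgraph) (V1 V2 : {set G}) :
  weak_bisection 4 V1 V2 ->
  defective (fun x => x \in V1) /\ balanced (fun x => x \in V1).
Proof.
case=> -[VU /pred0P dV cV] t1 t2.
have V2E x : (x \in V2) = (x \notin V1).
  have := dV x; have : x \in V1 :|: V2 by rewrite VU inE.
  by rewrite /= inE; do 2!case: (x \in _).
split=> [x y z xy xz cy cz|].
  have [xV|xV] := boolP (x \in V1).
    by apply: (tree_components2_edge _ _ _ _ _ t1 xV); rewrite ?cy ?cz.
  by apply: (tree_components2_edge _ _ x _ _ t2); rewrite ?V2E ?cy ?cz.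
move: cV; rewrite -!sum1_card big_mkcond [RHS]big_mkcond /= => cV.
apply: etrans cV _; apply: eq_bigr => x _; rewrite V2E; by case: (x \in V1).
Qed.

Lemma L0_coloring (c : L 0 -> bool) : defective c ->
  c (term_a (L 0)) != c (term_b (L 0)) /\ balanced c.
Proof.
move=> dc.
(* The guard on [i] keeps the removed edge from being used. *)
have h s i j k : j != k -> (i == ord0) ==> (j != ord0) && (k != ord0) ->
    ~~ ((c (~~ s, j) == c (s, i)) && (c (~~ s, k) == c (s, i))).
  move=> jk i0; apply/negP => /andP[/eqP cj /eqP ck].
  suff [jkE] : ((~~ s, j) : L 0) = (~~ s, k) by rewrite jkE eqxx in jk.
  apply: dc cj ck; rewrite /= /K33_minus_edge /=; move: i0;
  by case: s; case: (i == _); case: (j == _); case: (k == _).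
pose i0 : 'I_3 := ord0; pose i1 : 'I_3 := lift ord0 ord0.
pose i2 : 'I_3 := lift ord0 (lift ord0 ord0).
(* All pairs of neighbours on side [s]: three each for [i1] and [i2], one for [i0]. The 64
   colourings are then checked one by one. *)
have hs s := (h s i1 i0 i1 isT isT, h s i1 i0 i2 isT isT, h s i1 i1 i2 isT isT,
  h s i2 i0 i1 isT isT, h s i2 i0 i2 isT isT, h s i2 i1 i2 isT isT,
  h s i0 i1 i2 isT isT).
have sumE (F : bool * 'I_3 -> nat) :
    \sum_(p : L 0) F p = \sum_(s : bool) \sum_(i < 3) F (s, i).
  by rewrite pair_bigA; apply: eq_bigr => -[].
rewrite /balanced !sumE !big_bool !big_ord_recl !big_ord0 /=.
move: (hs true) (hs false); rewrite /= -/i0 -/i1 -/i2.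
by case: (c (true, i0)); case: (c (true, i1)); case: (c (true, i2));
   case: (c (false, i0)); case: (c (false, i1)); case: (c (false, i2));
   do 2![case=> [[[[[[? ?] ?] ?] ?] ?] ?]].
Qed.

Lemma L_coloring (k : nat) (c : L k -> bool) : defective c ->
  c (term_a (L k)) != c (term_b (L k)) /\ balanced c.
Proof.
elim: k c => [|k IH] c dc; first exact: L0_coloring.
have [abN bal] := IH _ (defective_Some _ _ _ (defective_Some _ _ _ dc)).
have uv : c (Some None) != c None.
  apply/eqP => uv; rewrite /= in abN.
  have [ua|uaN] := eqVneq (c (Some (Some (term_a (L k))))) (c (Some None)).
    by have /= := dc (Some None) (Some (Some (term_a (L k)))) None;
       rewrite !inE eqxx => /(_ isT isT ua (esym uv)).
  have vb : c (Some (Some (term_b (L k)))) = c None.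
    rewrite -uv; move: abN uaN.
    by case: (c _); case: (c _); case: (c _).
  by have /= := dc None (Some (Some (term_b (L k)))) (Some None);
     rewrite !inE !eqxx => /(_ isT isT vb uv).
split=> //; move: bal; rewrite /balanced /= !big_optionE /= => ->.
by move: uv; case: (c _); case: (c _).
Qed.

(** One of the two differently coloured terminals matches the new vertex. The equation says, without
    subtraction, that the colour of [None] is in excess by one. *)
Lemma L'_coloring (k : nat) (c : L' k -> bool) : defective c ->
  (exists2 x, edge (None : L' k) x & c x = c None) /\
  \sum_x (c x : nat) + ~~ c None = \sum_x (~~ c x : nat) + c None.
Proof.
move=> dc; have [abN bal] := L_coloring _ _ (defective_Some _ _ _ dc).
split; last by move: bal; rewrite !big_optionE /balanced /= => ->; lia.
have [ca|caN] := eqVneq (c (Some (term_a (L k)))) (c None).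
  by exists (Some (term_a (L k))); rewrite //= deg2_L !inE eqxx.
exists (Some (term_b (L k))); first by rewrite /= deg2_L !inE eqxx orbT.
by move: abN caN => /=; case: (c _); case: (c _); case: (c _).
Qed.

(** For a copy of [L' k] attached to an outside vertex [z]: the attaching vertex already has a
    neighbour of its own colour inside the copy, so [z] has the other colour, and the excess of one
    is against [z]. *)
Lemma L'_copy (k : nat) (G : sgraph) (f : L' k -> G) (z : G) (c : G -> bool) :
  injective f -> {homo f : x y / edge x y} -> (forall x, f x != z) ->
  edge (f None) z -> defective c ->
  c (f None) != c z /\
  \sum_x (c (f x) : nat) + c z = \sum_x (~~ c (f x) : nat) + ~~ c z.
Proof.
move=> finj fE fz wz dc.
have [[x wx cx] bal] := L'_coloring _ _ (defective_comp _ _ _ _ finj fE dc).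
have wzN : c (f None) != c z.
  apply/eqP => cwz; have /eqP := fz x; apply.
  by apply: (dc (f None)) => //; exact: fE.
by split=> //; move: bal wzN => /=; case: (c (f None)); case: (c z).
Qed.

Theorem proposition8 (k : nat) :
  ~ exists V1 V2 : {set T k}, weak_bisection 4 V1 V2.
Proof.
case=> V1 [V2 /weak_bisection4_coloring []].
move: (fun x => x \in V1) => c dc.
rewrite /balanced !big_optionE !big_sumType /=.
have [| | | |_ b1] := L'_copy k (T k) (fun x => Some (inl x)) None c _ _ _ _ dc.
- by move=> x y [].
- by [].
- by [].
(* The centre is joined to this vertex because its degree before the join is 2. *)
- by rewrite /= inE deg_dunion_inl deg_L'.
have [| | | |_ b2] :=
  L'_copy 0 (T k) (fun x => Some (inr (inl x))) None c _ _ _ _ dc.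
- by move=> x y [].
- by [].
- by [].
- by rewrite /= inE deg_dunion_inr deg_dunion_inl deg_L'.
have [| | | |_ b3] :=
  L'_copy 0 (T k) (fun x => Some (inr (inr x))) None c _ _ _ _ dc.
- by move=> x y [].
- by [].
- by [].
- by rewrite /= inE !deg_dunion_inr deg_L'.
move: b1 b2 b3; case: (c None) => /=; lia.
Qed.
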